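(* Assume $5\nmid n$. Let $u$ and $t$ be integers satisfying $5u\equiv1\pmod{\Delta_n}$ and $$t\equiv(n^2+3n+4)(11n^5+110n^4+440n^3+903n^2+940n+390)\Delta_n-un^2(11n^3+55n^2+110n+199)\delta_n^2\pmod{\Delta_n\delta_n^2}.$$ Let $T=\frac{f_n(\rho)-f_n(t)}{\rho-t}$, i.e. $T=(t^4+t^3\rho+t^2\rho^2+t\rho^3+\rho^4)+n^2(t^3+t^2\rho+t\rho^2+\rho^3)-(2n^3+6n^2+10n+10)(t^2+t\rho+\rho^2)+(n^4+5n^3+11n^2+15n+5)(t+\rho)+(n^3+4n^2+10n+10)$. Put $$\phi_1=\frac1e(\rho-t),\quad\phi_2=\frac{1}{cde^2}(\rho-t)^2,\quad\phi_3=\frac1{bcd^2e^3}(\rho-t)^3,\quad\phi_4=\frac{1}{bc^2d^3e^4\delta_n}T.$$ Then $\{1,\phi_1,\phi_2,\phi_3,\phi_4\}$ is an integral basis of $K_n$ (a $\mathbb Z$-basis of $\mathcal O_{K_n}$).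
   Context: $n$ is an integer and $f_n(X)=X^5+n^2X^4-(2n^3+6n^2+10n+10)X^3+(n^4+5n^3+11n^2+15n+5)X^2+(n^3+4n^2+10n+10)X+1$ (irreducible over $\mathbb Q$); $\rho$ is a root of $f_n$, $K_n=\mathbb Q(\rho)$ with ring of integers $\mathcal O_{K_n}$. $\delta_n=n^3+5n^2+10n+7$ and $\Delta_n=n^4+5n^3+15n^2+25n+25$; write $\Delta_n=ab^2c^3d^4e^5$ with $a,b,c,d,e$ positive integers, $a,b,c,d$ square-free and pairwise coprime. *)

(* Defs.v *)
From HB Require Import structures.
From mathcomp Require Import all_boot all_order all_algebra all_field.
From mathcomp Require Import ring.

Set Implicit Arguments.
Unset Strict Implicit.
Unset Printing Implicit Defensive.

Import GRing.Theory.

Local Open Scope ring_scope.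

Definition quintic (n : int) : {poly int} :=
  'X^5 + (n ^+ 2)%:P * 'X^4
  - (2 * n ^+ 3 + 6 * n ^+ 2 + 10 * n + 10)%:P * 'X^3
  + (n ^+ 4 + 5 * n ^+ 3 + 11 * n ^+ 2 + 15 * n + 5)%:P * 'X^2
  + (n ^+ 3 + 4 * n ^+ 2 + 10 * n + 10)%:P * 'X + 1.

Definition delta (n : int) : int := n ^+ 3 + 5 * n ^+ 2 + 10 * n + 7.

Definition Delta (n : int) : int :=
  n ^+ 4 + 5 * n ^+ 3 + 15 * n ^+ 2 + 25 * n + 25.

Definition squarefree (m : nat) : Prop :=
  forall k : nat, (k ^ 2 %| m)%N -> k = 1%N.

Section IntegralBasis.

Variable L : fieldExtType rat.

Definition ring_of_integers (K : {subfield L}) (x : L) : Prop :=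
  x \in K /\ integralOver (intr : int -> L) x.

Definition integral_basis (K : {subfield L}) (m : nat) (w : m.-tuple L) : Prop :=
  (forall x : L, ring_of_integers K x <->
     exists z : {ffun 'I_m -> int}, x = \sum_(i < m) tnth w i *~ z i) /\
  (forall z : {ffun 'I_m -> int},
     \sum_(i < m) tnth w i *~ z i = 0 -> forall i, z i = 0).

Definition quintic_quotient (n t : int) (rho : L) : L :=
  ((map_poly intr (quintic n)).[rho] - ((quintic n).[t])%:~R) / (rho - t%:~R).

(* The hypothesis always holds at a root rho of the quintic, as the latter is
   irreducible over the rationals. *)
Lemma quintic_quotientE (n t : int) (rho : L) (N := n%:~R : L) (s := t%:~R : L) :
  rho != s ->
  quintic_quotient n t rho =
    (s ^+ 4 + s ^+ 3 * rho + s ^+ 2 * rho ^+ 2 + s * rho ^+ 3 + rho ^+ 4)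
    + N ^+ 2 * (s ^+ 3 + s ^+ 2 * rho + s * rho ^+ 2 + rho ^+ 3)
    - (2 * N ^+ 3 + 6 * N ^+ 2 + 10 * N + 10) * (s ^+ 2 + s * rho + rho ^+ 2)
    + (N ^+ 4 + 5 * N ^+ 3 + 11 * N ^+ 2 + 15 * N + 5) * (s + rho)
    + (N ^+ 3 + 4 * N ^+ 2 + 10 * N + 10).
Proof.
rewrite -subr_eq0 => nz; apply: (mulIf nz); rewrite divfK //.
have mE (A B C D : int) :
    map_poly (intr : int -> L) ('X^5 + A%:P * 'X^4 - B%:P * 'X^3 + C%:P * 'X^2
      + D%:P * 'X + 1) =
    'X^5 + (A%:~R)%:P * 'X^4 - (B%:~R)%:P * 'X^3 + (C%:~R)%:P * 'X^2
      + (D%:~R)%:P * 'X + 1.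
  rewrite !rmorphD rmorphN /= !(rmorphM _ _%:P) /=.
  by rewrite !map_polyC !map_polyXn map_polyX rmorph1.
rewrite /quintic mE !(hornerD, hornerN, hornerM, hornerC, hornerX, hornerXn).
rewrite /N /s; ring.
Qed.

End IntegralBasis.

(* Main.v *)
Require Import Defs.
From mathcomp Require Import all_boot all_order all_algebra all_field.
From mathcomp Require Import ring zify.

Set Implicit Arguments.
Unset Strict Implicit.
Unset Printing Implicit Defensive.

Import GRing.Theory Num.Theory.

Local Open Scope ring_scope.

(* The quintic f_n is irreducible mod 2, hence over Q, so that integrality of
   P(rho) can be tested on P(r) for the complex roots r of f_n.  Write
   theta = rho - t and f_n(Y + t) = Y^5 + c4 Y^4 + ... + c0.  The congruences on
   t say that t = - n^2 / 5 mod Delta and t = - (n^2 + 3n + 4) mod delta^2, which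
   makes Delta divide all the ci with c0 / Delta prime to Delta, delta^2 divide
   c0 and delta divide c1.
   - The phi_i are integral: theta^5 is Delta times an integral element, so
     theta^j / m is integral as soon as m^5 divides Delta^j; and T / delta is a
     root of a monic quadratic polynomial with integral coefficients.
   - The discriminant of f_n being delta^2 Delta^4, that of the phi_i is
     (abcd)^4; by Cramer's rule an integral element has coordinates whose
     denominators divide (abcd)^2.
   - At a prime p dividing abcd, theta / e has p-adic valuation k / 5 with
     0 < k < 5, and the valuations of the phi_i are distinct modulo 1; so p
     divides all the coordinates of any element of p O_K lying in the span of
     the phi_i. *)

(** * Irreducibility modulo 2 *)

Lemma horner_quintic (R : comNzRingType) (n : int) (x : R) (N := n%:~R : R) :
  (map_poly intr (quintic n)).[x] =
    x ^+ 5 + N ^+ 2 * x ^+ 4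
    - (2 * N ^+ 3 + 6 * N ^+ 2 + 10 * N + 10) * x ^+ 3
    + (N ^+ 4 + 5 * N ^+ 3 + 11 * N ^+ 2 + 15 * N + 5) * x ^+ 2
    + (N ^+ 3 + 4 * N ^+ 2 + 10 * N + 10) * x + 1.
Proof.
have evalE (A B C D : int) :
    (map_poly intr ('X^5 + A%:P * 'X^4 - B%:P * 'X^3 + C%:P * 'X^2
       + D%:P * 'X + 1)).[x] =
    x ^+ 5 + A%:~R * x ^+ 4 - B%:~R * x ^+ 3 + C%:~R * x ^+ 2 + D%:~R * x + 1.
  rewrite !rmorphD rmorphN /= !(rmorphM _ _%:P) /= !map_polyC !map_polyXn.
  by rewrite map_polyX rmorph1 !hornerE.
by rewrite evalE /N; ring.
Qed.

Lemma size_quintic n : size (quintic n) = 6%N.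
Proof.
have sizeD (p q : {poly int}) :
    (size p <= 5)%N -> (size q <= 5)%N -> (size (p + q)%R <= 5)%N.
  by move=> sp sq; rewrite (leq_trans (size_polyD _ _)) // geq_max sp.
have sizeZ (k : int) (i : nat) : (i < 5)%N -> (size (k *: 'X^i)%R <= 5)%N.
  by move=> i5; rewrite (leq_trans (size_scale_leq _ _)) // size_polyXn.
rewrite /quintic -!addrA size_polyDl size_polyXn // !mul_polyC -!scaleNr ltnS.
do 3![apply: (sizeD); first exact: (sizeZ)].
by apply: sizeD; [exact: (sizeZ _ 1%N) | rewrite size_poly1].
Qed.

Lemma monic_quintic n : quintic n \is monic.
Proof.
rewrite monicE lead_coefE size_quintic /= /quintic.
by rewrite !(coefD, coefN, coefCM, coefXn, coefX, coef1) /=; apply/eqP; ring.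
Qed.

Lemma Aint_ratP (q : rat) : ratr q \in Aint -> exists z : int, q = z%:~R.
Proof.
move=> qA; have /intrP[z qE] := Cint_rat_Aint (Crat_rat q) qA.
exists z; apply: (fmorph_inj (ratr : {rmorphism rat -> algC})).
by rewrite /= ratr_int.
Qed.

Lemma Aint_div (p : nat) (z : int) :
  (0 < p)%N -> z%:~R / p%:R \in Aint -> (p%:Z %| z)%Z.
Proof.
move=> p0 zA; have [|w wE] := @Aint_ratP (z%:~R / p%:R).
  by rewrite rmorphM fmorphV /= ratr_int ratr_nat.
apply/dvdzP; exists w; apply: (@intr_inj rat); rewrite intrM -wE divfK //.
by rewrite pnatr_eq0 -lt0n.
Qed.

Ltac solve_Aint := repeat first
  [ done | exact: Aint_int | exact: rpred_nat | apply: rpredD | rewrite rpredN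
  | apply: rpredM | apply: rpredX ].

Section ModTwo.
Variables (n : int) (r : algC).
Hypothesis r_root : root (map_poly intr (quintic n)) r.

Lemma quintic_root_Aint : r \in Aint.
Proof.
apply: root_monic_Aint r_root _ _; first exact: (monic_map _ (monic_quintic n)).
by apply/polyOverP => i; rewrite coef_map /= intr_int.
Qed.

(** Elements of (1/2) Z[r]. Irreducibility mod 2 is used in the form: such an element is an
    algebraic integer only when all its coefficients are even. *)
Definition half_comb (z0 z1 z2 z3 z4 : int) : algC :=
  (z0%:~R + z1%:~R * r + z2%:~R * r ^+ 2 + z3%:~R * r ^+ 3 + z4%:~R * r ^+ 4) / 2.

Lemma half_comb_mod2 z0 z1 z2 z3 z4 w0 w1 w2 w3 w4 :
    [/\ (2 %| z0 - w0)%Z, (2 %| z1 - w1)%Z, (2 %| z2 - w2)%Z, (2 %| z3 - w3)%Z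
      & (2 %| z4 - w4)%Z] ->
  half_comb w0 w1 w2 w3 w4 \in Aint -> half_comb z0 z1 z2 z3 z4 \in Aint.
Proof.
case=> /dvdzP[k0 e0] /dvdzP[k1 e1] /dvdzP[k2 e2] /dvdzP[k3 e3] /dvdzP[k4 e4] wA.
have -> : half_comb z0 z1 z2 z3 z4 = half_comb w0 w1 w2 w3 w4 +
   (k0%:~R + k1%:~R * r + k2%:~R * r ^+ 2 + k3%:~R * r ^+ 3 + k4%:~R * r ^+ 4).
  have -> : z0 = k0 * 2 + w0 by rewrite -e0 subrK.
  have -> : z1 = k1 * 2 + w1 by rewrite -e1 subrK.
  have -> : z2 = k2 * 2 + w2 by rewrite -e2 subrK.
  have -> : z3 = k3 * 2 + w3 by rewrite -e3 subrK.
  have -> : z4 = k4 * 2 + w4 by rewrite -e4 subrK.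
  by rewrite /half_comb; field.
have rA := quintic_root_Aint.
by solve_Aint.
Qed.

Lemma half_comb_step z0 z1 z2 z3 z4 :
  half_comb z0 z1 z2 z3 z4 \in Aint ->
  half_comb (- z4) (z0 - (n ^+ 3 + 4 * n ^+ 2 + 10 * n + 10) * z4)
    (z1 - (n ^+ 4 + 5 * n ^+ 3 + 11 * n ^+ 2 + 15 * n + 5) * z4)
    (z2 + (2 * n ^+ 3 + 6 * n ^+ 2 + 10 * n + 10) * z4) (z3 - n ^+ 2 * z4)
  \in Aint.
Proof.
move=> zA; have rA := quintic_root_Aint.
set w := (X in X \in _); suff -> : w = r * half_comb z0 z1 z2 z3 z4.
  exact: rpredM.
move/rootP: r_root; rewrite horner_quintic => r0.
rewrite -[LHS]addr0 -(mulr0 (z4%:~R / 2)) -r0 /w /half_comb.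
by field.
Qed.

(* Multiplication by a root of the quintic on F_2[X]/(quintic); it only depends
   on the parity m of n. *)
Definition shift2 (m : bool) (v : bool * bool * bool * bool * bool) :=
  let: (b0, b1, b2, b3, b4) := v in
  (b4, b0 (+) (m && b4), b1 (+) b4, b2, b3 (+) (m && b4)).

(** The unit group of the field with 32 elements has prime order 31, so X generates it: from any
    nonzero class, fewer than 31 multiplications by X lead to 1. *)
Lemma shift2_orbit m v : v != (false, false, false, false, false) ->
  exists k, iter k (shift2 m) v = (true, false, false, false, false).
Proof.
move=> v0; suff: has (fun k => iter k (shift2 m) v ==
    (true, false, false, false, false)) (iota 0 31).
  by case/hasP => k _ /eqP; exists k.
by move: v0; case: v => [[[[]]]]; case: m; do 5![case]; vm_compute.
Qed.

Definition half_bool (v : bool * bool * bool * bool * bool) :=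
  let: (b0, b1, b2, b3, b4) := v in half_comb b0 b1 b2 b3 b4.

Lemma half_bool_shift2 v :
  half_bool v \in Aint -> half_bool (shift2 (odd `|n|%N) v) \in Aint.
Proof.
case: v => [[[[b0 b1] b2] b3] b4] /= /half_comb_step; apply: half_comb_mod2.
have [k nE] : exists k, n = 2 * k + (odd `|n|%N : nat)%:Z.
  exists (n %/ 2)%Z; have := divz_eq n 2.
  lia.
move: (odd `|n|%N) nE => m ->.
by split; case: m b0 b1 b2 b3 b4 => [] [] [] [] [] [] /=; lia.
Qed.

(** With an odd coefficient, reduction to parities and multiplication by a power of [r] would make
    1/2 an algebraic integer. *)
Lemma half_comb_even z0 z1 z2 z3 z4 : half_comb z0 z1 z2 z3 z4 \in Aint ->
  [/\ (2 %| z0)%Z, (2 %| z1)%Z, (2 %| z2)%Z, (2 %| z3)%Z & (2 %| z4)%Z].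
Proof.
move=> zA; pose o (z : int) := odd `|z|%N.
pose v := (o z0, o z1, o z2, o z3, o z4).
have vA : half_bool v \in Aint.
  by apply: half_comb_mod2 zA; rewrite /o; split; lia.
have [[]|/(shift2_orbit (odd `|n|%N))[k vk]] :=
    eqVneq v (false, false, false, false, false).
  by rewrite /o; split; lia.
have : half_bool (iter k (shift2 (odd `|n|%N)) v) \in Aint.
  by elim: k {vk} => //= k IHk; exact: half_bool_shift2.
rewrite vk /half_bool /half_comb !mul0r !addr0 => h.
by have := @Aint_div 2 1 isT h.
Qed.
End ModTwo.

(** A nonzero relation could be scaled to a primitive integral one; half of it is 0, an algebraic
    integer, so all its coefficients would be even. *)
Lemma quintic_root_free (n : int) (r : algC) (p : {poly rat}) :
  root (map_poly intr (quintic n)) r -> (size p <= 5)%N ->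
  root (map_poly ratr p) r -> p = 0.
Proof.
move=> fr; have [q [a a0 ->]] := rat_poly_scale p.
have aQ0 : (a%:~R : rat)^-1 != 0 by rewrite invr_eq0 intr_eq0.
rewrite size_scale // size_map_inj_poly //; last exact: intr_inj.
rewrite map_polyZ rootZ ?fmorph_eq0 // => szq.
rewrite -map_poly_comp (eq_map_poly (g := intr)); last first.
  by move=> z /=; rewrite ratr_int.
have [->|q0] := eqVneq q 0; first by rewrite !rmorph0 scaler0.
rewrite {1}[q]zpolyEprim map_polyZ rootZ ?intr_eq0 ?zcontents_eq0 //.
set w := zprimitive q => /rootP wr.
have szw : (size w <= 5)%N by rewrite size_zprimitive.
have /(half_comb_even fr)[e0 e1 e2 e3 e4] :
    half_comb r w`_0 w`_1 w`_2 w`_3 w`_4 \in Aint.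
  rewrite /half_comb; set s := (X in X / 2); suff -> : s = 0 by rewrite mul0r.
  rewrite -wr (@horner_coef_wide _ 5) ?(leq_trans (size_poly _ _)) //.
  by rewrite !big_ord_recl big_ord0 !coef_map /= /s /bump /=; ring.
have /negP[] : ~~ (2 %| zcontents w)%Z by rewrite zcontents_primitive q0.
rewrite dvdz_contents; apply/polyOverP => i.
case: i => [|[|[|[|[|i]]]]] //; rewrite nth_default //.
by apply: leq_trans szw _.
Qed.

Lemma irreducible_quintic n :
  irreducible_poly (map_poly intr (quintic n) : {poly rat}).
Proof.
have szf : size (map_poly intr (quintic n) : {poly rat}) = 6%N.
  by rewrite size_map_inj_poly ?size_quintic //; exact: intr_inj.
split=> [|q q1 qf]; first by rewrite szf.
have /closed_rootP[r qr] : size (map_poly ratr q : {poly algC}) != 1%N.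
  by rewrite size_map_poly.
have fr : root (map_poly intr (quintic n)) r.
  move: qf => /dvdpP[g gE]; rewrite (eq_map_poly (g := ratr \o intr)); last first.
    by move=> z /=; rewrite ratr_int.
  by rewrite map_poly_comp gE rmorphM /= rootM qr orbT.
have fn0 : map_poly intr (quintic n) != 0 :> {poly rat}.
  by rewrite -size_poly_eq0 szf.
rewrite -dvdp_size_eqp // eqn_leq dvdp_leq //= szf leqNgt ltnS.
apply/negP => szq; have q0 := quintic_root_free fr szq qr.
by move: qf; rewrite q0 dvd0p (negPf fn0).
Qed.

(** * Transfer of integrality between fields *)

Lemma root_irreducible (F : fieldType) (iota : {rmorphism rat -> F})
    (p q : {poly rat}) (x : F) :
  irreducible_poly p -> root (map_poly iota p) x ->
  root (map_poly iota q) x = (p %| q).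
Proof.
move=> irr px; apply/idP/idP => [qx|/dvdpP[g ->]]; last first.
  by rewrite rmorphM /= rootM px orbT.
rewrite -[_ %| _]negbK; apply/negP => npq.
have : coprimep (map_poly iota p) (map_poly iota q).
  by rewrite coprimep_map irreducible_poly_coprime.
by move/coprimep_root => /(_ _ px); rewrite (rootP qx) eqxx.
Qed.

(** For a monic integral [q], q(g(x)) = 0 means that [p] divides the composite of [q] and [g], a
    condition that involves neither the field nor the root. *)
Lemma integral_transfer (E F : fieldType) (iE : {rmorphism rat -> E})
    (iF : {rmorphism rat -> F}) (p g : {poly rat}) (x : E) (y : F) :
  irreducible_poly p -> root (map_poly iE p) x -> root (map_poly iF p) y ->
  integralOver (intr : int -> E) (map_poly iE g).[x] ->
  integralOver (intr : int -> F) (map_poly iF g).[y].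
Proof.
move=> irr px py [q qmon qx]; exists q => //; move: qx.
have compE (K : fieldType) (iK : {rmorphism rat -> K}) (z : K) :
    root (map_poly intr q) (map_poly iK g).[z] =
    root (map_poly iK (map_poly intr q \Po g)) z.
  rewrite map_comp_poly /root horner_comp -map_poly_comp.
  by congr (_.[_] == 0); apply: eq_map_poly => k /=; rewrite rmorph_int.
by rewrite !compE (root_irreducible _ irr px) (root_irreducible _ irr py).
Qed.

Lemma integral_algC (x : algC) : integralOver (intr : int -> algC) x <-> x \in Aint.
Proof.
split=> [[q qmon qx]|xA].
  apply: root_monic_Aint qx (monic_map _ qmon) _.
  by apply/polyOverP => i; rewrite coef_map /= intr_int.
have /floorpP[q qE] : minCpoly x \is a polyOver Num.int := xA.
have := root_minCpoly x; have := minCpoly_monic x; rewrite qE => qmon qx.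
exists q => //; move: qmon; rewrite !monicE lead_coef_map_inj //;
  last exact: intr_inj.
by rewrite -[X in _ == X](rmorph1 (intr : {rmorphism int -> algC})) eqr_int.
Qed.

(** * The discriminant *)

(* Unlike \det, this expansion reduces to an explicit polynomial. *)
Fixpoint laplace (R : pzRingType) n (F : nat -> nat -> R) : R :=
  if n is m.+1 then
    foldr (fun j s => (-1) ^+ j
        * (F 0%N j * laplace m (fun i k => F i.+1 (bump j k))) + s)
      0 (iota 0 n)
  else 1.

Lemma det_laplace (R : comPzRingType) n (F : nat -> nat -> R) :
  \det (\matrix_(i < n, j < n) F i j) = laplace n F.
Proof.
elim: n F => [|n IHn] F; first by rewrite det_mx00.
rewrite (expand_det_row _ ord0) [RHS]/(foldr _ _ _).
pose term j := (-1) ^+ j * (F 0%N j * laplace n (fun i k => F i.+1 (bump j k))).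
transitivity (\sum_(j < n.+1) term j).
  apply: eq_bigr => j _; rewrite mxE /cofactor add0n mulrCA /term -IHn.
  congr (_ * (_ * \det _)); apply/matrixP => i k; rewrite !mxE /=.
  by rewrite /bump leq0n.
by rewrite -(big_mkord xpredT term) unlock /index_iota subn0.
Qed.

(** The [hi] are the power sums of the roots of f_n, the first four in closed form and the others by
    Newton's recurrence; the Hankel determinant is thus the discriminant of f_n. *)
Lemma det_hankel_quintic (R : comNzRingType) (n h1 h2 h3 h4 h5 h6 h7 h8 : R)
  (B := 2 * n ^+ 3 + 6 * n ^+ 2 + 10 * n + 10)
  (C := n ^+ 4 + 5 * n ^+ 3 + 11 * n ^+ 2 + 15 * n + 5)
  (D := n ^+ 3 + 4 * n ^+ 2 + 10 * n + 10) :
  h1 = - n ^+ 2 ->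
  h2 = n ^+ 4 + 4 * n ^+ 3 + 12 * n ^+ 2 + 20 * n + 20 ->
  h3 = - n ^+ 6 - 6 * n ^+ 5 - 21 * n ^+ 4 - 45 * n ^+ 3 - 63 * n ^+ 2 - 45 * n
    - 15 ->
  h4 = n ^+ 8 + 8 * n ^+ 7 + 36 * n ^+ 6 + 108 * n ^+ 5 + 236 * n ^+ 4
    + 376 * n ^+ 3 + 444 * n ^+ 2 + 360 * n + 160 ->
  h5 = - n ^+ 2 * h4 + B * h3 - C * h2 - D * h1 - 5 ->
  h6 = - n ^+ 2 * h5 + B * h4 - C * h3 - D * h2 - h1 ->
  h7 = - n ^+ 2 * h6 + B * h5 - C * h4 - D * h3 - h2 ->
  h8 = - n ^+ 2 * h7 + B * h6 - C * h5 - D * h4 - h3 ->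
  \det (\matrix_(i < 5, j < 5) [:: 5; h1; h2; h3; h4; h5; h6; h7; h8]`_(i + j)) =
    (n ^+ 3 + 5 * n ^+ 2 + 10 * n + 7) ^+ 2
    * (n ^+ 4 + 5 * n ^+ 3 + 15 * n ^+ 2 + 25 * n + 25) ^+ 4.
Proof.
rewrite (det_laplace 5 (fun i j => _`_(i + j))).
set s := (_ :: _); rewrite /= /bump /= /addn /addn_rec /=.
move=> e1 e2 e3 e4 e5 e6 e7 e8.
rewrite e8 e7 e6 e5 e4 e3 e2 e1 /B /C /D.
ring.
Qed.

Lemma quintic_split n : exists x : 'rV[algC]_5,
  map_poly intr (quintic n) = \prod_(j < 5) ('X - (x 0 j)%:P).
Proof.
have [s sE] := closed_field_poly_normal (map_poly intr (quintic n) : {poly algC}).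
have fm : (map_poly intr (quintic n) : {poly algC}) \is monic.
  exact: (monic_map _ (monic_quintic n)).
move: sE; rewrite (monicP fm) scale1r => sE.
have szs : size s = 5%N.
  apply/eqP; rewrite -eqSS -(size_prod_XsubC s id) -sE.
  by rewrite size_map_inj_poly ?size_quintic //; exact: intr_inj.
exists (\row_j s`_j); rewrite sE (big_nth 0) big_mkord szs.
by apply: eq_bigr => j _; rewrite mxE.
Qed.

Lemma quintic_coefs n : [/\
  (quintic n)`_1 = n ^+ 3 + 4 * n ^+ 2 + 10 * n + 10,
  (quintic n)`_2 = n ^+ 4 + 5 * n ^+ 3 + 11 * n ^+ 2 + 15 * n + 5,
  (quintic n)`_3 = - (2 * n ^+ 3 + 6 * n ^+ 2 + 10 * n + 10) &
  (quintic n)`_4 = n ^+ 2].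
Proof.
by rewrite /quintic; split;
  rewrite !(coefD, coefN, coefCM, coefXn, coefX, coef1) /=; ring.
Qed.

Lemma prod_XsubC5 (R : comNzRingType) (a b c d e : R) :
  ('X - a%:P) * ('X - b%:P) * ('X - c%:P) * ('X - d%:P) * ('X - e%:P) =
  'X^5 - (a + b + c + d + e)%:P * 'X^4
  + (a * b + a * c + a * d + a * e + b * c + b * d + b * e + c * d + c * e
     + d * e)%:P * 'X^3
  - (a * b * c + a * b * d + a * b * e + a * c * d + a * c * e + a * d * e
     + b * c * d + b * c * e + b * d * e + c * d * e)%:P * 'X^2
  + (a * b * c * d + a * b * c * e + a * b * d * e + a * c * d * e
     + b * c * d * e)%:P * 'X
  - (a * b * c * d * e)%:P.
Proof. by ring. Qed.

(** The product of the Vandermonde matrix by its transpose is the Hankel matrix of the power sums,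
    which Newton's identities compute from the coefficients of f_n. *)
Lemma quintic_disc n (x : 'rV[algC]_5) :
  map_poly intr (quintic n) = \prod_(j < 5) ('X - (x 0 j)%:P) ->
  \det (Vandermonde 5 x) ^+ 2 = (delta n ^+ 2 * Delta n ^+ 4)%:~R.
Proof.
move=> fE; pose N : algC := n%:~R.
have x_root j : (map_poly intr (quintic n)).[x 0 j] = 0.
  by rewrite fE horner_prod (bigD1 j) //= hornerXsubC subrr mul0r.
pose a : algC := x 0 (inord 0); pose b : algC := x 0 (inord 1).
pose c : algC := x 0 (inord 2); pose d : algC := x 0 (inord 3).
pose e : algC := x 0 (inord 4).
have sumE (F : 'I_5 -> algC) :
    \sum_j F j = F (inord 0) + F (inord 1) + F (inord 2) + F (inord 3) + F (inord 4).
  rewrite !big_ord_recr big_ord0 /= add0r.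
  by congr (F _ + F _ + F _ + F _ + F _); apply/val_inj; rewrite /= inordK.
have prodE : \prod_(j < 5) ('X - (x 0 j)%:P) =
    ('X - a%:P) * ('X - b%:P) * ('X - c%:P) * ('X - d%:P) * ('X - e%:P).
  rewrite !big_ord_recr big_ord0 /= mul1r /a /b /c /d /e.
  by do 4?[congr (_ * _)]; congr ('X - (x 0 _)%:P); apply/val_inj; rewrite /= inordK.
move: fE; rewrite prodE prod_XsubC5 => fE.
pose p k : algC := \sum_j x 0 j ^+ k.
have coefE i : ((quintic n)`_i)%:~R = (map_poly intr (quintic n) : {poly algC})`_i.
  by rewrite coef_map.
have [q1 q2 q3 q4] := quintic_coefs n.
have := coefE 4%N; have := coefE 3%N; have := coefE 2%N; have := coefE 1%N.
rewrite q1 q2 q3 q4 fE !(coefD, coefN, coefCM, coefC, coefXn, coefX) /=.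
rewrite !(mulr0, mulr1, addr0, add0r, subr0, sub0r, oppr0) => c1 c2 c3 c4.
have p0 : p 0%N = 5 by rewrite /p sumE !expr0; ring.
have p1 : p 1%N = - N ^+ 2.
  have -> : N ^+ 2 = (n ^+ 2)%:~R by rewrite /N; ring.
  by rewrite /p sumE c4 -/a -/b -/c -/d -/e; ring.
have p2 : p 2 = N ^+ 4 + 4 * N ^+ 3 + 12 * N ^+ 2 + 20 * N + 20.
  transitivity (p 1%N ^+ 2 - 2 * (- (2 * n ^+ 3 + 6 * n ^+ 2 + 10 * n + 10))%:~R).
    by rewrite c3 /p !sumE -/a -/b -/c -/d -/e; ring.
  by rewrite p1 /N; ring.
have p3 : p 3 = - N ^+ 6 - 6 * N ^+ 5 - 21 * N ^+ 4 - 45 * N ^+ 3 - 63 * N ^+ 2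
    - 45 * N - 15.
  transitivity (p 1%N * p 2 - (- (2 * n ^+ 3 + 6 * n ^+ 2 + 10 * n + 10))%:~R * p 1%N
     - 3 * (n ^+ 4 + 5 * n ^+ 3 + 11 * n ^+ 2 + 15 * n + 5)%:~R).
    by rewrite c3 c2 /p !sumE -/a -/b -/c -/d -/e; ring.
  by rewrite p1 p2 /N; ring.
have p4 : p 4 = N ^+ 8 + 8 * N ^+ 7 + 36 * N ^+ 6 + 108 * N ^+ 5 + 236 * N ^+ 4
    + 376 * N ^+ 3 + 444 * N ^+ 2 + 360 * N + 160.
  transitivity (p 1%N * p 3 - (- (2 * n ^+ 3 + 6 * n ^+ 2 + 10 * n + 10))%:~R * p 2
     - (n ^+ 4 + 5 * n ^+ 3 + 11 * n ^+ 2 + 15 * n + 5)%:~R * p 1%N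
     - 4 * (n ^+ 3 + 4 * n ^+ 2 + 10 * n + 10)%:~R).
    by rewrite c3 c2 c1 /p !sumE -/a -/b -/c -/d -/e; ring.
  by rewrite p1 p2 p3 /N; ring.
(* Sum over j of the relations x_j^k f_n(x_j) = 0. *)
have pS k : p (k + 5)%N = - N ^+ 2 * p (k + 4)%N
    + (2 * N ^+ 3 + 6 * N ^+ 2 + 10 * N + 10) * p (k + 3)%N
    - (N ^+ 4 + 5 * N ^+ 3 + 11 * N ^+ 2 + 15 * N + 5) * p (k + 2)%N
    - (N ^+ 3 + 4 * N ^+ 2 + 10 * N + 10) * p (k + 1)%N - p k.
  apply/eqP; rewrite -subr_eq0 -sumrN !mulr_sumr -!big_split -!sumrN -!big_split /=.
  rewrite -sumrB; apply/eqP/big1 => j _; have := x_root j.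
  rewrite horner_quintic -/N => xj0; rewrite -[RHS](mulr0 (x 0 j ^+ k)) -xj0 !exprD.
  by ring.
have p5 := pS 0%N; have p6 := pS 1%N; have p7 := pS 2%N; have p8 := pS 3%N.
rewrite /= p0 in p5.
have detE := det_hankel_quintic p1 p2 p3 p4 p5 p6 p7 p8.
rewrite expr2 -[X in _ * X]det_tr -det_mulmx.
transitivity ((N ^+ 3 + 5 * N ^+ 2 + 10 * N + 7) ^+ 2
  * (N ^+ 4 + 5 * N ^+ 3 + 15 * N ^+ 2 + 25 * N + 25) ^+ 4); last first.
  by rewrite /delta /Delta /N; ring.
rewrite -detE; congr (\det _); apply/matrixP => i j; rewrite !mxE.
transitivity (p (i + j)%N).
  by apply: eq_bigr => k _; rewrite !mxE exprD.
have : (i + j < 9)%N by have := ltn_ord i; have := ltn_ord j; lia.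
by case: (i + j)%N => [|[|[|[|[|[|[|[|[|m]]]]]]]]].
Qed.

(** * Consequences of the congruences on t *)

(* Coefficients of the Taylor expansion of the quintic at t, that is
   f_n(Y + t) = Y^5 + tc4 Y^4 + tc3 Y^3 + tc2 Y^2 + tc1 Y + tc0. *)
Definition tc0 (n t : int) : int :=
  t ^+ 5 + n ^+ 2 * t ^+ 4 - (2 * n ^+ 3 + 6 * n ^+ 2 + 10 * n + 10) * t ^+ 3
  + (n ^+ 4 + 5 * n ^+ 3 + 11 * n ^+ 2 + 15 * n + 5) * t ^+ 2
  + (n ^+ 3 + 4 * n ^+ 2 + 10 * n + 10) * t + 1.
Definition tc1 (n t : int) : int :=
  5 * t ^+ 4 + 4 * n ^+ 2 * t ^+ 3
  - 3 * (2 * n ^+ 3 + 6 * n ^+ 2 + 10 * n + 10) * t ^+ 2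
  + 2 * (n ^+ 4 + 5 * n ^+ 3 + 11 * n ^+ 2 + 15 * n + 5) * t
  + (n ^+ 3 + 4 * n ^+ 2 + 10 * n + 10).
Definition tc2 (n t : int) : int :=
  10 * t ^+ 3 + 6 * n ^+ 2 * t ^+ 2
  - 3 * (2 * n ^+ 3 + 6 * n ^+ 2 + 10 * n + 10) * t
  + (n ^+ 4 + 5 * n ^+ 3 + 11 * n ^+ 2 + 15 * n + 5).
Definition tc3 (n t : int) : int :=
  10 * t ^+ 2 + 4 * n ^+ 2 * t - (2 * n ^+ 3 + 6 * n ^+ 2 + 10 * n + 10).
Definition tc4 (n t : int) : int := 5 * t + n ^+ 2.

(** With K and M as in the proof, K delta^2 - M Delta = 1, so the hypothesis on t is the Chinese
    remainder form of t = - n^2 / 5 mod Delta and t = - (n^2 + 3n + 4) mod delta^2. *)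
Lemma t_residues (n u t : int) :
  (5 * u = 1 %[mod Delta n])%Z ->
  (t = (n ^+ 2 + 3 * n + 4)
         * (11 * n ^+ 5 + 110 * n ^+ 4 + 440 * n ^+ 3 + 903 * n ^+ 2
            + 940 * n + 390) * Delta n
       - u * n ^+ 2 * (11 * n ^+ 3 + 55 * n ^+ 2 + 110 * n + 199)
         * delta n ^+ 2
    %[mod Delta n * delta n ^+ 2])%Z ->
  exists s w, 5 * t + n ^+ 2 = Delta n * s
    /\ t = - (n ^+ 2 + 3 * n + 4) + delta n ^+ 2 * w.
Proof.
move/eqP; rewrite eqz_mod_dvd => /dvdzP[k1 uE].
move/eqP; rewrite eqz_mod_dvd => /dvdzP[k2 /(canRL (subrK _)) tE].
have {}uE : u * 5 = k1 * Delta n + 1 by rewrite -uE; ring.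
pose K := 11 * n ^+ 3 + 55 * n ^+ 2 + 110 * n + 199.
pose M := 11 * n ^+ 5 + 110 * n ^+ 4 + 440 * n ^+ 3 + 903 * n ^+ 2 + 940 * n + 390.
exists (5 * (n ^+ 2 + 3 * n + 4) * M + 5 * k2 * delta n ^+ 2 - n ^+ 2 * M
  - n ^+ 2 * K * delta n ^+ 2 * k1).
(* The polynomial of degree 5 is (n^2 + 3n + 4) K, since M Delta + 1 = K delta^2. *)
exists (11 * n ^+ 5 + 88 * n ^+ 4 + 319 * n ^+ 3 + 749 * n ^+ 2 + 1037 * n + 796
  + k2 * Delta n - u * n ^+ 2 * K).
split; last by rewrite tE /K /M /delta /Delta; ring.
rewrite tE -/K -/M.
transitivity (5 * ((n ^+ 2 + 3 * n + 4) * M * Delta n)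
    + 5 * k2 * (Delta n * delta n ^+ 2)
    - (u * 5) * n ^+ 2 * K * delta n ^+ 2 + n ^+ 2); first by ring.
by rewrite uE /K /M /delta /Delta; ring.
Qed.

Lemma coprime_delta_Delta n : coprimez (delta n) (Delta n).
Proof.
apply/coprimezP; exists ((11 * n ^+ 3 + 55 * n ^+ 2 + 110 * n + 199) * delta n,
 - (11 * n ^+ 5 + 110 * n ^+ 4 + 440 * n ^+ 3 + 903 * n ^+ 2 + 940 * n + 390)).
by rewrite /= /delta /Delta; ring.
Qed.

Section Residues.
Variables n t s w : int.
Hypothesis t_Delta : 5 * t + n ^+ 2 = Delta n * s.
Hypothesis t_delta : t = - (n ^+ 2 + 3 * n + 4) + delta n ^+ 2 * w.
Hypothesis cop5 : coprimez 5 (Delta n).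

Let Gauss5 k c x : 5 ^+ k * c = Delta n * x -> (Delta n %| c)%Z.
Proof.
move=> E; rewrite -(@Gauss_dvdzr _ (5 ^+ k)) ?E ?dvdz_mulr //.
by rewrite coprimez_sym coprimezXl.
Qed.

Let y := Delta n * s.

(** In the variable y = 5t + n^2, 5^5 f_n(t) is y^5 plus Delta times a polynomial in y, so f_n is a
    fifth power modulo Delta. The other coefficients come from the derivatives of this identity, and
    the powers of 5 are removed by [Gauss5]. *)
Lemma Delta_dvd_tc : [/\ (Delta n %| tc0 n t)%Z, (Delta n %| tc1 n t)%Z,
  (Delta n %| tc2 n t)%Z, (Delta n %| tc3 n t)%Z & (Delta n %| tc4 n t)%Z].
Proof.
split.
- apply: (@Gauss5 5 _ (Delta n ^+ 4 * s ^+ 5 + (-10 * y ^+ 3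
    + (20 * n ^+ 2 + 50 * n + 25) * y ^+ 2
    + (- 15 * n ^+ 4 - 75 * n ^+ 3 - 100 * n ^+ 2 + 250) * y
    + (4 * n ^+ 6 + 30 * n ^+ 5 + 65 * n ^+ 4 - 200 * n ^+ 2 - 125 * n + 125)))).
  transitivity (y ^+ 5 + Delta n * (-10 * y ^+ 3
    + (20 * n ^+ 2 + 50 * n + 25) * y ^+ 2
    + (- 15 * n ^+ 4 - 75 * n ^+ 3 - 100 * n ^+ 2 + 250) * y
    + (4 * n ^+ 6 + 30 * n ^+ 5 + 65 * n ^+ 4 - 200 * n ^+ 2 - 125 * n + 125))).
    by rewrite /y -t_Delta /tc0 /Delta; ring.
  by rewrite /y; ring.
- apply: (@Gauss5 4 _ (5 * Delta n ^+ 3 * s ^+ 4 + (-30 * y ^+ 2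
    + 2 * (20 * n ^+ 2 + 50 * n + 25) * y
    + (- 15 * n ^+ 4 - 75 * n ^+ 3 - 100 * n ^+ 2 + 250)))).
  transitivity (5 * y ^+ 4 + Delta n * (-30 * y ^+ 2
    + 2 * (20 * n ^+ 2 + 50 * n + 25) * y
    + (- 15 * n ^+ 4 - 75 * n ^+ 3 - 100 * n ^+ 2 + 250))).
    by rewrite /y -t_Delta /tc1 /Delta; ring.
  by rewrite /y; ring.
- apply: (@Gauss5 3 _ (10 * Delta n ^+ 2 * s ^+ 3 + (-30 * y
    + (20 * n ^+ 2 + 50 * n + 25)))).
  transitivity (10 * y ^+ 3 + Delta n * (-30 * y + (20 * n ^+ 2 + 50 * n + 25))).
    by rewrite /y -t_Delta /tc2 /Delta; ring.
  by rewrite /y; ring.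
- apply: (@Gauss5 2 _ (10 * Delta n * s ^+ 2 - 10)).
  transitivity (10 * y ^+ 2 - 10 * Delta n).
    by rewrite /y -t_Delta /tc3 /Delta; ring.
  by rewrite /y; ring.
by rewrite /tc4 t_Delta dvdz_mulr.
Qed.

(** Modulo Delta, 5^5 g0 is congruent to [G], the constant term in y of the cofactor of Delta above.
    The Bezout identity A G + B Delta = 5^5 then leaves only 5 as a possible common prime, and 5 is
    prime to Delta. *)
Lemma coprime_tc0_Delta (g0 : int) :
  Delta n != 0 -> tc0 n t = Delta n * g0 -> coprimez g0 (Delta n).
Proof.
move=> D0 c0E; pose G := 4 * n ^+ 6 + 30 * n ^+ 5 + 65 * n ^+ 4 - 200 * n ^+ 2
  - 125 * n + 125.
pose H := Delta n ^+ 3 * s ^+ 5 + (-10 * Delta n ^+ 2 * s ^+ 3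
    + (20 * n ^+ 2 + 50 * n + 25) * Delta n * s ^+ 2
    + (- 15 * n ^+ 4 - 75 * n ^+ 3 - 100 * n ^+ 2 + 250) * s).
have GE : 5 ^+ 5 * g0 = Delta n * H + G.
  apply: (mulfI D0).
  transitivity (5 ^+ 5 * tc0 n t); first by rewrite c0E; ring.
  transitivity (y ^+ 5 + Delta n * (-10 * y ^+ 3
    + (20 * n ^+ 2 + 50 * n + 25) * y ^+ 2
    + (- 15 * n ^+ 4 - 75 * n ^+ 3 - 100 * n ^+ 2 + 250) * y + G)).
    by rewrite /y -t_Delta /tc0 /G /Delta; ring.
  by rewrite /H /y; ring.
have /coprimezP[[a b] /= abE] : coprimez (5 ^+ 5) (Delta n) by rewrite coprimezXl.
apply/coprimezP.
pose A := -15 - 20 * n - 7 * n ^+ 2 - 3 * n ^+ 3.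
pose B := 200 - 175 * n - 130 * n ^+ 2 + 15 * n ^+ 3 + 58 * n ^+ 4 + 12 * n ^+ 5.
have AB : A * G + B * Delta n = 5 ^+ 5 by rewrite /A /B /G /Delta; ring.
exists (a * A * 5 ^+ 5, a * (B - A * H) + b); rewrite /= -[RHS]abE.
transitivity (a * A * (5 ^+ 5 * g0) + (a * (B - A * H) + b) * Delta n).
  by ring.
transitivity (a * (A * G + B * Delta n) + b * Delta n); first by rewrite GE; ring.
by rewrite AB.
Qed.

(** [v] is a double root of f_n modulo delta, with f_n(v) = - delta^3; as t = v modulo delta^2, both
    divisibilities pass from v to t. *)
Lemma delta_dvd_tc : (delta n ^+ 2 %| tc0 n t)%Z /\ (delta n %| tc1 n t)%Z.
Proof.
pose v := - (n ^+ 2 + 3 * n + 4).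
have v0 : tc0 n v = delta n ^+ 2 * - delta n by rewrite /v /tc0 /delta; ring.
have v1 : tc1 n v = delta n * (n ^+ 5 + 13 * n ^+ 4 + 63 * n ^+ 3 + 156 * n ^+ 2
  + 200 * n + 110) by rewrite /v /tc1 /delta; ring.
have tv : t - v = delta n ^+ 2 * w by rewrite t_delta /v; ring.
(* The value of [v] is forgotten, so that [ring] treats it as an indeterminate. *)
move: v v0 v1 tv => v v0 v1 tv; split.
  have -> : tc0 n t = tc0 n v + (t - v) *
    ((t ^+ 4 + t ^+ 3 * v + t ^+ 2 * v ^+ 2 + t * v ^+ 3 + v ^+ 4)
    + n ^+ 2 * (t ^+ 3 + t ^+ 2 * v + t * v ^+ 2 + v ^+ 3)
    - (2 * n ^+ 3 + 6 * n ^+ 2 + 10 * n + 10) * (t ^+ 2 + t * v + v ^+ 2)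
    + (n ^+ 4 + 5 * n ^+ 3 + 11 * n ^+ 2 + 15 * n + 5) * (t + v)
    + (n ^+ 3 + 4 * n ^+ 2 + 10 * n + 10)) by rewrite /tc0; ring.
  by rewrite tv v0 -(mulrA _ w) -mulrDr dvdz_mulr.
have -> : tc1 n t = tc1 n v + (t - v) *
    (5 * (t ^+ 3 + t ^+ 2 * v + t * v ^+ 2 + v ^+ 3)
    + 4 * n ^+ 2 * (t ^+ 2 + t * v + v ^+ 2)
    - 3 * (2 * n ^+ 3 + 6 * n ^+ 2 + 10 * n + 10) * (t + v)
    + 2 * (n ^+ 4 + 5 * n ^+ 3 + 11 * n ^+ 2 + 15 * n + 5)) by rewrite /tc1; ring.
by rewrite tv v1 expr2 -(mulrA _ w) -(mulrA _ (delta n)) -mulrDr dvdz_mulr.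
Qed.
End Residues.

(** * Primes dividing abcd *)

Lemma Aint_root m (x : algC) : (0 < m)%N -> x ^+ m \in Aint -> x \in Aint.
Proof.
move=> m0 xmA; apply/integral_algC.
apply: (@integral_root_monic _ _ _ _ ('X^m - (x ^+ m)%:P)).
- exact: monicXnsubC.
- by rewrite /root !hornerE subrr.
- apply/integral_poly => i; rewrite coefB coefXn coefC.
  apply/integral_algC; apply: rpredB; first exact: rpred_nat.
  by case: ifP.
Qed.

Section TotallyRamified.

(** Valuations are handled without prime ideals: [V] is a unit at p, because V V' is congruent
    modulo p to an integer prime to p. So eta has valuation k/5. *)
Variables (p k : nat) (eta V V' iota : algC) (w : int).
Hypotheses (p_pr : prime p) (k_gt0 : (0 < k)%N) (k_lt5 : (k < 5)%N).
Hypothesis eta5 : eta ^+ 5 = p%:R ^+ k * V.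
Hypotheses (V_Aint : V \in Aint) (V'_Aint : V' \in Aint) (iota_Aint : iota \in Aint).
Hypotheses (VV' : V * V' = w%:~R + p%:R * iota) (w_ndvd : ~~ (p%:Z %| w)%Z).

Let p0 : (p%:R : algC) != 0.
Proof. by rewrite pnatr_eq0 -lt0n prime_gt0. Qed.

Lemma eta_frac_exp5 j m :
  (eta ^+ j / p%:R ^+ m) ^+ 5 = p%:R ^+ (k * j) * V ^+ j / p%:R ^+ (5 * m).
Proof. by rewrite expr_div_n -exprM mulnC exprM eta5 exprMn -!exprM (mulnC m). Qed.

Lemma eta_frac_Aint j m : (5 * m <= k * j)%N -> eta ^+ j / p%:R ^+ m \in Aint.
Proof.
move=> le_mj; apply: (@Aint_root 5) => //; rewrite eta_frac_exp5.
rewrite -(subnK le_mj) exprD mulrAC mulfK ?expf_neq0 //.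
by solve_Aint.
Qed.

(* eta^j / p^m has valuation -1/5, so only multiples of p make it integral. *)
Lemma eta_frac_dvd (z : int) j m : (k * j).+1 = (5 * m)%N ->
  z%:~R * (eta ^+ j / p%:R ^+ m) \in Aint -> (p%:Z %| z)%Z.
Proof.
move=> jm zA.
(* Multiplication by V'^j replaces the unit V^j by the integer w^j modulo p, so this element is z^5
   w^j / p up to an algebraic integer. *)
have : (z%:~R * (eta ^+ j / p%:R ^+ m)) ^+ 5 * V' ^+ j \in Aint by solve_Aint.
rewrite exprMn eta_frac_exp5 -jm (exprS _ (k * j)) invfM.
have [x xA xE] : exists2 x, x \in Aint & V ^+ j * V' ^+ j = (w ^+ j)%:~R + p%:R * x.
  rewrite -exprMn VV'; elim: j {jm zA} => [|j [x xA xE]].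
    by exists 0; rewrite ?rpred0 // !expr0 mulr0 addr0.
  exists ((w ^+ j)%:~R * iota + w%:~R * x + p%:R * x * iota); first by solve_Aint.
  by rewrite exprSr xE exprSr intrM; ring.
have -> : z%:~R ^+ 5 * (p%:R ^+ (k * j) * V ^+ j * (p%:R^-1 / p%:R ^+ (k * j)))
      * V' ^+ j = (z ^+ 5 * w ^+ j)%:~R / p%:R + z%:~R ^+ 5 * x.
  transitivity (z%:~R ^+ 5 * (V ^+ j * V' ^+ j) / p%:R).
    by field; rewrite p0 expf_neq0.
  by rewrite xE; field.
have zx : z%:~R ^+ 5 * x \in Aint by solve_Aint.
rewrite (rpredDr _ zx) => /(Aint_div (prime_gt0 p_pr)).
rewrite dvdzE abszM !abszX Euclid_dvdM // => /orP[].
  by rewrite Euclid_dvdX // andbT.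
by rewrite Euclid_dvdX // => /andP[wp _]; move: w_ndvd; rewrite dvdzE wp.
Qed.

(* The valuations {j k / 5} of the eta^j / p^(j k / 5) are distinct, so the
   coefficients can be isolated one at a time by increasing valuation. *)
Lemma eta_comb_dvd (z : nat -> int) :
    \sum_(j < 5) (z j)%:~R * (eta ^+ j / p%:R ^+ (k * j %/ 5).+1) \in Aint ->
  forall j, (j < 5)%N -> (p%:Z %| z j)%Z.
Proof.
move=> zA j; move Di: (k * j %% 5)%N => i.
elim/ltn_ind: i j Di => i IHi j Di j5.
(* Apart from z_j, the term of index j has valuation i/5 - 1; the factor [mu] of valuation (4 - i)/5
   brings it to -1/5, where [eta_frac_dvd] applies. The witness for j' uses k^4 = 1 mod 5. *)
have [j' j'i] : exists j', (k * j' %% 5 = 4 - i)%N.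
  have i5 : (i < 5)%N by rewrite -Di ltn_pmod.
  exists (k ^ 3 * (4 - i))%N.
  move: k_gt0 k_lt5 i5; case: k => [|[|[|[|[|]]]]] //;
    by case: i {IHi Di} => [|[|[|[|[|]]]]].
pose mu := eta ^+ j' / p%:R ^+ (k * j' %/ 5).
have muA : mu \in Aint by apply: eta_frac_Aint; lia.
apply: (@eta_frac_dvd _ (j + j') ((k * j %/ 5).+1 + k * j' %/ 5)); first by lia.
have := rpredM zA muA; rewrite (bigD1 (Ordinal j5)) //= mulrDl.
set S := (X in _ + X * mu); have SA : S * mu \in Aint.
  rewrite mulr_suml; apply: rpred_sum => l lj.
  have lj' : l <> j :> nat by move=> E; move/eqP: lj; apply; apply: val_inj.
  have l5 := ltn_ord l.
  (* The other terms become integral: p divides z_l by induction if the residue is smaller, and the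
     valuation suffices if it is larger. Equal residues force l = j, as k is invertible mod 5. *)
  have [li|li|li] := ltngtP (k * l %% 5)%N i.
  - have /dvdzP[y yE] := IHi _ li l erefl l5.
    have lA : eta ^+ l / p%:R ^+ (k * l %/ 5) \in Aint by apply: eta_frac_Aint; lia.
    suff -> : (z l)%:~R * (eta ^+ l / p%:R ^+ (k * l %/ 5).+1) =
        y%:~R * (eta ^+ l / p%:R ^+ (k * l %/ 5)) by solve_Aint.
    by rewrite yE intrM exprS; field; rewrite p0 expf_neq0.
  - rewrite -mulrA; apply: rpredM; first exact: Aint_int.
    rewrite /mu mulf_div -!exprD; apply: eta_frac_Aint; lia.
  - case: lj'; move: k_gt0 k_lt5 li; rewrite -Di; clear -l5 j5.
    by case: k => [|[|[|[|[|]]]]] //; lia.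
by rewrite (rpredDr _ SA) /mu -mulrA mulf_div -!exprD.
Qed.

End TotallyRamified.

(** * The basis *)

Lemma Aint_quadratic (x s m : algC) :
  s \in Aint -> m \in Aint -> x ^+ 2 = s * x + m -> x \in Aint.
Proof.
move=> sA mA xE; apply/integral_algC.
have pE : 'X^2 - s *: 'X - m%:P = 'X^2 + Poly [:: - m; - s].
  by rewrite /= !cons_poly_def mul0r add0r polyCN mulNr mul_polyC polyCN; ring.
apply: (@integral_root_monic _ _ _ _ ('X^2 - s *: 'X - m%:P)).
- rewrite monicE pE lead_coefDl ?lead_coefXn // size_polyXn.
  exact: leq_ltn_trans (size_Poly _) _.
- by rewrite /root !hornerE xE; apply/eqP; ring.
- apply/integral_poly => i; rewrite !coefB coefXn coefZ coefX coefC.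
  apply/integral_algC; apply: rpredB; first apply: rpredB.
  + exact: rpred_nat.
  + by apply: rpredM => //; exact: rpred_nat.
  + by case: ifP.
Qed.

Lemma det_Aint m (A : 'M[algC]_m) :
  (forall i j, A i j \in Aint) -> \det A \in Aint.
Proof.
move=> AA; rewrite /determinant; apply: rpred_sum => s _.
by apply: rpredM; [exact: rpred_sign | apply: rpred_prod => i _].
Qed.

Lemma cramer_Aint m (A : 'M[algC]_m) (y : 'rV[algC]_m) :
  (forall i j, A i j \in Aint) -> (forall j, (y *m A) 0 j \in Aint) ->
  forall i, y 0 i * \det A \in Aint.
Proof.
move=> AA yA i.
have : (y *m A *m \adj A) 0 i \in Aint.
  rewrite mxE; apply: rpred_sum => j _; apply: rpredM => //.
  rewrite mxE /cofactor; apply: rpredM.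
    by apply: rpredX; rewrite rpredN rpred1.
  by apply: det_Aint => k l; rewrite !mxE.
by rewrite -mulmxA mul_mx_adj mul_mx_scalar mxE mulrC.
Qed.

(** The value [delta n] is always odd. *)
Lemma delta_neq0 n : delta n != 0.
Proof.
apply/eqP => d0.
have [k [nE|nE]] : exists k : int, n = 2 * k \/ n = 2 * k + 1.
  by exists (n %/ 2)%Z; lia.
- have : delta n = 2 * (4 * k ^+ 3 + 10 * k ^+ 2 + 10 * k + 3) + 1.
    by rewrite nE /delta; ring.
  by rewrite d0; lia.
- have : delta n = 2 * (4 * k ^+ 3 + 16 * k ^+ 2 + 23 * k + 11) + 1.
    by rewrite nE /delta; ring.
  by rewrite d0; lia.
Qed.

(** With F(Y) = f_n(Y + t), this is (F(x) - F(0)) / x, that is T when x = rho - t. *)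
Definition tail_eval (F : fieldType) (n t : int) (x : F) : F :=
  x ^+ 4 + (tc4 n t)%:~R * x ^+ 3 + (tc3 n t)%:~R * x ^+ 2 + (tc2 n t)%:~R * x
  + (tc1 n t)%:~R.

(** The field is a parameter, to serve both for rho and for the complex roots of f_n. *)
Definition basis_seq (F : fieldType) (n t : int) (b c d e : nat) (x : F) : seq F :=
  [:: 1; x / e%:R; x ^+ 2 / (c * d * e ^ 2)%N%:R;
      x ^+ 3 / (b * c * d ^ 2 * e ^ 3)%N%:R;
      tail_eval n t x / ((b * c ^ 2 * d ^ 3 * e ^ 4)%N%:R * (delta n)%:~R)].

(* Coefficients, in powers of rho - t, of the combination with coordinates y. *)
Definition comb_coefs (n t : int) (b c d e : nat) (y : nat -> rat) : seq rat :=
  let M := (b * c ^ 2 * d ^ 3 * e ^ 4)%N%:R * (delta n)%:~R in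
  [:: y 0%N + y 4%N * (tc1 n t)%:~R / M;
      y 1%N / e%:R + y 4%N * (tc2 n t)%:~R / M;
      y 2%N / (c * d * e ^ 2)%N%:R + y 4%N * (tc3 n t)%:~R / M;
      y 3%N / (b * c * d ^ 2 * e ^ 3)%N%:R + y 4%N * (tc4 n t)%:~R / M;
      y 4%N / M].

Definition comb_poly (n t : int) (b c d e : nat) (y : nat -> rat) : {poly rat} :=
  Poly (comb_coefs n t b c d e y) \Po ('X - (t%:~R)%:P).

Lemma size_comb_poly n t b c d e y : (size (comb_poly n t b c d e y) <= 5)%N.
Proof. by rewrite /comb_poly size_comp_poly2 ?size_XsubC // size_Poly. Qed.

Lemma horner_comb_poly (F : fieldType) (iota : {rmorphism rat -> F})
    n t b c d e y (r : F) :
  (map_poly iota (comb_poly n t b c d e y)).[r] =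
  \sum_(i < 5) iota (y i) * (basis_seq n t b c d e (r - t%:~R))`_i.
Proof.
rewrite /comb_poly map_comp_poly horner_comp map_Poly horner_Poly.
rewrite map_polyXsubC hornerXsubC rmorph_int.
rewrite !big_ord_recl big_ord0 /= /bump /= !(rmorphD iota) !fmorph_div.
rewrite !(rmorphM iota (y 4%N)) (rmorphM iota _%:R _%:~R) !rmorph_int !rmorph_nat.
by rewrite /tail_eval; ring.
Qed.


(** * Existence and uniqueness of rational coordinates *)

Section Coordinates.

Variables (n t : int) (b c d e : nat).
Hypotheses (b0 : (0 < b)%N) (c0 : (0 < c)%N) (d0 : (0 < d)%N) (e0 : (0 < e)%N).

Let natQ_neq0 (m : nat) : (0 < m)%N -> (m%:R : rat) != 0.
Proof. by rewrite pnatr_eq0 -lt0n. Qed.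

Let nzQ := (natQ_neq0 b0, natQ_neq0 c0, natQ_neq0 d0, natQ_neq0 e0).

Let deltaQ_neq0 : (delta n)%:~R != 0 :> rat.
Proof. by rewrite intr_eq0 delta_neq0. Qed.

Lemma comb_polyP (P : {poly rat}) :
  (size P <= 5)%N -> exists y, P = comb_poly n t b c d e y.
Proof.
move=> szP; pose Q := P \Po ('X + (t%:~R)%:P).
have szQ : (size Q <= 5)%N by rewrite /Q size_comp_poly2 // size_XaddC.
pose M : rat := (b * c ^ 2 * d ^ 3 * e ^ 4)%N%:R * (delta n)%:~R.
(* Back substitution in the triangular system given by the Taylor coefficients of P at t. *)
exists (nth 0 [:: Q`_0 - Q`_4 * (tc1 n t)%:~R;
  (Q`_1 - Q`_4 * (tc2 n t)%:~R) * e%:R;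
  (Q`_2 - Q`_4 * (tc3 n t)%:~R) * (c * d * e ^ 2)%N%:R;
  (Q`_3 - Q`_4 * (tc4 n t)%:~R) * (b * c * d ^ 2 * e ^ 3)%N%:R; Q`_4 * M]).
have -> : P = Q \Po ('X - (t%:~R)%:P).
  by rewrite /Q -comp_polyA comp_polyD comp_polyX comp_polyC subrK comp_polyXr.
congr (_ \Po _); apply/polyP => i.
rewrite coef_Poly /comb_coefs /= -/M !(natrM, natrX).
have M0 : M != 0 by rewrite /M !(natrM, natrX) !mulf_neq0 ?expf_neq0 ?nzQ.
case: i => [|[|[|[|[|i]]]]] /=;
  last by rewrite nth_nil nth_default // (leq_trans szQ).
all: by field; rewrite ?M0 ?nzQ.
Qed.

Lemma comb_poly_eq0 y :
  comb_poly n t b c d e y = 0 -> forall i, (i < 5)%N -> y i = 0.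
Proof.
move=> y0; have Q0 : Poly (comb_coefs n t b c d e y) = 0.
  have := congr1 (comp_poly ('X + (t%:~R)%:P)) y0.
  rewrite /comb_poly -comp_polyA comp_polyB comp_polyX comp_polyC addrK.
  by rewrite comp_polyXr comp_poly0.
have cE i : (comb_coefs n t b c d e y)`_i = 0 by rewrite -coef_Poly Q0 coef0.
set M : rat := (b * c ^ 2 * d ^ 3 * e ^ 4)%N%:R * (delta n)%:~R.
have M0 : M != 0 by rewrite /M !(natrM, natrX) !mulf_neq0 ?expf_neq0 ?nzQ.
have divI (u v : rat) : v != 0 -> u / v = 0 -> u = 0.
  by move=> v0 /eqP; rewrite mulf_eq0 invr_eq0 (negPf v0) orbF => /eqP.
have y4 : y 4%N = 0 by apply: (divI _ M M0); exact: (cE 4%N).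
have := (cE 0%N, cE 1%N, cE 2, cE 3); rewrite /= y4 !mul0r !addr0.
move=> [[[y0E y1E] y2E] y3E] i.
case: i => [|[|[|[|[|i]]]]] // _;
  first [exact: y0E | apply: divI y1E | apply: divI y2E | apply: divI y3E];
  by rewrite natQ_neq0 // !(muln_gt0, expn_gt0) ?b0 ?c0 ?d0 ?e0.
Qed.

End Coordinates.

Section Basis.

Variables (n t : int) (a b c d e : nat) (g0 g1 g2 g3 g4 k0 k1 : int).
Hypotheses (a0 : (0 < a)%N) (b0 : (0 < b)%N) (c0 : (0 < c)%N) (d0 : (0 < d)%N)
  (e0 : (0 < e)%N).
Hypothesis DE : Delta n = (a * b ^ 2 * c ^ 3 * d ^ 4 * e ^ 5)%N%:Z.
Hypotheses (tc0E : tc0 n t = Delta n * g0) (tc1E : tc1 n t = Delta n * g1)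
  (tc2E : tc2 n t = Delta n * g2) (tc3E : tc3 n t = Delta n * g3)
  (tc4E : tc4 n t = Delta n * g4).
Hypotheses (tc0E' : tc0 n t = delta n ^+ 2 * k0) (tc1E' : tc1 n t = delta n * k1).
Hypothesis cop_g0 : coprimez g0 (Delta n).
Hypothesis sqf : [/\ squarefree a, squarefree b, squarefree c & squarefree d].
Hypothesis cop : pairwise coprime [:: a; b; c; d].

Let natr_neq0 (m : nat) : (0 < m)%N -> (m%:R : algC) != 0.
Proof. by rewrite pnatr_eq0 -lt0n. Qed.

Let delta_nz : (delta n)%:~R != 0 :> algC.
Proof. by rewrite intr_eq0 delta_neq0. Qed.

Let nz := (natr_neq0 a0, natr_neq0 b0, natr_neq0 c0, natr_neq0 d0, natr_neq0 e0).

(** * Integrality of the basis, and divisibility at a single complex root *)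

Section Root.
Variable r : algC.
Hypothesis r_root : root (map_poly intr (quintic n)) r.

Let x : algC := r - t%:~R.

Let xA : x \in Aint.
Proof. by have := quintic_root_Aint r_root; rewrite /x => rA; solve_Aint. Qed.

Lemma tail_evalM : tail_eval n t x * x = - (tc0 n t)%:~R.
Proof.
apply/eqP; rewrite -subr_eq0 opprK; apply/eqP.
rewrite -[RHS](rootP r_root) horner_quintic /tail_eval /x /tc0 /tc1 /tc2 /tc3 /tc4.
by ring.
Qed.

(** The quotient x^5 / Delta, congruent to - g0 modulo x. *)
Definition root5_cofactor : algC :=
  - (g0%:~R + x * (g1%:~R + g2%:~R * x + g3%:~R * x ^+ 2 + g4%:~R * x ^+ 3)).

Lemma root_exp5 : x ^+ 5 = (Delta n)%:~R * root5_cofactor.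
Proof.
have := tail_evalM; rewrite /tail_eval tc0E tc1E tc2E tc3E tc4E !intrM => E.
apply/eqP; rewrite -subr_eq0; apply/eqP.
move: E => /eqP; rewrite -subr_eq0 => /eqP E; rewrite -[RHS]E.
by rewrite /root5_cofactor; ring.
Qed.

Let hA : root5_cofactor \in Aint.
Proof. by rewrite /root5_cofactor; solve_Aint. Qed.

Lemma root_frac_Aint j m q : (0 < m)%N ->
  (m ^ 5 * q)%N%:Z = Delta n ^+ j -> x ^+ j / m%:R \in Aint.
Proof.
move=> m0 mE; apply: (@Aint_root 5) => //.
have -> : (x ^+ j / m%:R) ^+ 5 = q%:R * root5_cofactor ^+ j; last by solve_Aint.
rewrite expr_div_n -exprM mulnC exprM root_exp5 exprMn -rmorphXn /= -mE.
by rewrite -pmulrn natrM natrX; field; rewrite natr_neq0.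
Qed.

(** Write T = y x + c1. As T x = - c0, T^2 = c1 T - c0 y; division by delta^2 gives a monic
    quadratic equation for T / delta. *)
Lemma tail_delta_Aint : tail_eval n t x / (delta n)%:~R \in Aint.
Proof.
pose y := x ^+ 3 + (tc4 n t)%:~R * x ^+ 2 + (tc3 n t)%:~R * x + (tc2 n t)%:~R.
have yA : y \in Aint by rewrite /y; solve_Aint.
apply: (@Aint_quadratic _ k1%:~R (- (k0%:~R * y)));
  [exact: Aint_int | by solve_Aint |].
have TE : tail_eval n t x = y * x + (tc1 n t)%:~R by rewrite /tail_eval /y; ring.
have T2 : tail_eval n t x ^+ 2 = (tc1 n t)%:~R * tail_eval n t x - (tc0 n t)%:~R * y.
  transitivity (tail_eval n t x * x * y + (tc1 n t)%:~R * tail_eval n t x).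
    by rewrite expr2 [X in _ * X = _]TE; ring.
  by rewrite tail_evalM; ring.
rewrite expr_div_n T2 tc0E' tc1E'.
by field; rewrite delta_nz.
Qed.

(** T / m and T / delta are integral, and a Bezout relation between delta and m, a divisor of Delta,
    combines them. *)
Lemma tail_Aint :
  tail_eval n t x / ((b * c ^ 2 * d ^ 3 * e ^ 4)%N%:R * (delta n)%:~R) \in Aint.
Proof.
set m := (b * c ^ 2 * d ^ 3 * e ^ 4)%N.
have m0 : (0 < m)%N by rewrite !(muln_gt0, expn_gt0) b0 c0 d0 e0.
have DmE : Delta n = m%:Z * (a * b * c * d * e)%N%:Z.
  by rewrite DE /m; ring.
have TmA : tail_eval n t x / m%:R \in Aint.
  (* Since c1, ..., c4 are multiples of Delta = m abcde, only x^4 / m remains to be treated. *)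
  have -> : tail_eval n t x / m%:R = x ^+ 4 / m%:R + (a * b * c * d * e)%N%:R *
      (g4%:~R * x ^+ 3 + g3%:~R * x ^+ 2 + g2%:~R * x + g1%:~R).
    rewrite /tail_eval tc1E tc2E tc3E tc4E DmE !intrM -!pmulrn.
    by field; rewrite natr_neq0.
  have xmA : x ^+ 4 / m%:R \in Aint.
    apply: (@root_frac_Aint _ _ (a ^ 4 * b ^ 3 * c ^ 2 * d)) => //.
    by rewrite DE /m; ring.
  by solve_Aint.
have TdA := tail_delta_Aint.
have /coprimezP[[u v] /= uvE] : coprimez (delta n) m.
  by have := coprime_delta_Delta n; rewrite DmE coprimezMr; case/andP.
have -> : tail_eval n t x / (m%:R * (delta n)%:~R) =
    u%:~R * (tail_eval n t x / m%:R) + v%:~R * (tail_eval n t x / (delta n)%:~R).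
  have uvC : u%:~R * (delta n)%:~R + v%:~R * m%:R = 1 :> algC.
    by rewrite [m%:R]pmulrn -!intrM -intrD uvE.
  transitivity (tail_eval n t x * (u%:~R * (delta n)%:~R + v%:~R * m%:R)
     / (m%:R * (delta n)%:~R)); first by rewrite uvC mulr1.
  by field; rewrite natr_neq0 // delta_nz.
by solve_Aint.
Qed.

Lemma basis_Aint i : (basis_seq n t b c d e x)`_i \in Aint.
Proof.
case: i => [|[|[|[|[|i]]]]] /=; last by rewrite nth_nil rpred0.
- exact: rpred1.
- rewrite -[x]expr1; apply: (@root_frac_Aint _ _ (a * b ^ 2 * c ^ 3 * d ^ 4)) => //.
  by rewrite DE; ring.
- apply: (@root_frac_Aint _ _ (a ^ 2 * b ^ 4 * c * d ^ 3)).
    by rewrite !(muln_gt0, expn_gt0) c0 d0 e0.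
  by rewrite DE; ring.
- apply: (@root_frac_Aint _ _ (a ^ 3 * b * c ^ 4 * d ^ 2)).
    by rewrite !(muln_gt0, expn_gt0) b0 c0 d0 e0.
  by rewrite DE; ring.
- exact: tail_Aint.
Qed.

(** Common form of the cases where p divides a, b, c or d, with k = 1, 2, 3, 4 respectively. [D] and
    the [Ri] are the parts prime to p of Delta / e^5 and of the denominators without e and delta;
    powers of e go into eta = x / e, since p may divide e too. *)
Lemma basis_local_core (p k D R2 R3 R4 : nat) (z : nat -> int) :
    prime p -> (0 < k)%N -> (k < 5)%N -> (p %| a * b * c * d)%N ->
    (a * b ^ 2 * c ^ 3 * d ^ 4 = p ^ k * D)%N ->
    (c * d = p ^ (k * 2 %/ 5) * R2)%N ->
    (b * c * d ^ 2 = p ^ (k * 3 %/ 5) * R3)%N ->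
    (b * c ^ 2 * d ^ 3 = p ^ (k * 4 %/ 5) * R4)%N ->
    ~~ (p %| D * (R2 * R3 * R4))%N ->
    (\sum_(i < 5) (z i)%:~R * (basis_seq n t b c d e x)`_i) / p%:R \in Aint ->
  forall i, (i < 5)%N -> (p%:Z %| z i)%Z.
Proof.
move=> p_pr k_gt0 k_lt5 /dvdnP[q qE] DpE R2E R3E R4E.
rewrite !Euclid_dvdM // !negb_or => /and3P[pD /andP[pR2 pR3] pR4] zA.
have p_gt0 := prime_gt0 p_pr.
have R_gt0 m : ~~ (p %| m)%N -> (0 < m)%N by case: m => //; rewrite dvdn0.
have DpE' : Delta n = p%:Z * (q * b * c ^ 2 * d ^ 3 * e ^ 5)%N%:Z.
  have -> : (q * b * c ^ 2 * d ^ 3 * e ^ 5 = q * (b * c ^ 2 * d ^ 3 * e ^ 5))%N.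
    by ring.
  by rewrite -PoszM mulnA (mulnC p) -qE DE; ring.
have pg0 : ~~ (p%:Z %| g0)%Z.
  apply/negP => pg0; have : (p%:Z %| gcdz g0 (Delta n))%Z.
    by rewrite dvdz_gcd pg0 DpE' dvdz_mulr.
  by rewrite (eqP cop_g0) dvdzE /= dvdn1; case: (p) p_pr => [|[|]].
pose eta := x / e%:R.
pose i1 := g1%:~R + g2%:~R * x + g3%:~R * x ^+ 2 + g4%:~R * x ^+ 3.
have i1A : i1 \in Aint by rewrite /i1; solve_Aint.
(* As x^5 is a multiple of Delta, p divides be^5; hence V' = (g0^5 + be^5) / (g0 + be) satisfies V
   V' = - D g0^5 modulo p. *)
pose be := x * i1.
have beA : be \in Aint by rewrite /be; solve_Aint.
have hE : root5_cofactor = - (g0%:~R + be) by [].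
pose V := D%:R * root5_cofactor.
have VA : V \in Aint by rewrite /V; solve_Aint.
pose V' := g0%:~R ^+ 4 - g0%:~R ^+ 3 * be + g0%:~R ^+ 2 * be ^+ 2
  - g0%:~R * be ^+ 3 + be ^+ 4.
have V'A : V' \in Aint by rewrite /V'; solve_Aint.
pose io := - D%:R * (q * b * c ^ 2 * d ^ 3 * e ^ 5)%N%:R * root5_cofactor * i1 ^+ 5.
have ioA : io \in Aint by rewrite /io; solve_Aint.
have be5 : be ^+ 5 = p%:R * (q * b * c ^ 2 * d ^ 3 * e ^ 5)%N%:R
    * root5_cofactor * i1 ^+ 5.
  by rewrite /be exprMn root_exp5 DpE' intrM -!pmulrn.
have VVE : V * V' = (- (D%:Z * g0 ^+ 5))%:~R + p%:R * io.
  transitivity (- D%:R * (g0%:~R ^+ 5 + be ^+ 5)); first by rewrite /V hE /V'; ring.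
  by rewrite be5 /io; ring.
have wN : ~~ (p%:Z %| - (D%:Z * g0 ^+ 5))%Z.
  rewrite dvdzE abszN abszM abszX /= Euclid_dvdM // Euclid_dvdX // negb_or pD andbT.
  by move: pg0; rewrite dvdzE.
have eta5 : eta ^+ 5 = p%:R ^+ k * V.
  rewrite /eta expr_div_n root_exp5 DE DpE -pmulrn !(natrM, natrX) /V.
  by field; rewrite !nz.
(* The combination is multiplied by delta R2 R3 R4, prime to p, to leave only p and e in the
   denominators. *)
pose z' := nth 0 [:: z 0%N * delta n * (R2 * R3 * R4)%N;
  z 1%N * delta n * (R2 * R3 * R4)%N; z 2%N * delta n * (R3 * R4)%N;
  z 3%N * delta n * (R2 * R4)%N; z 4%N * (R2 * R3)%N].
have : \sum_(j < 5) (z' j)%:~R * (eta ^+ j / p%:R ^+ (k * j %/ 5).+1) \in Aint.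
  set S := (X in X / _ \in _) in zA.
  (* T - x^4 is Delta times an integral element and Delta = p q e m with m = b c^2 d^3 e^4, so T can
     be replaced by x^4 up to an algebraic integer. *)
  pose ze := e%:R * (g4%:~R * x ^+ 3 + g3%:~R * x ^+ 2 + g2%:~R * x + g1%:~R).
  have zeA' : ze \in Aint by rewrite /ze; solve_Aint.
  set S' := (X in X \in _).
  have -> : S' = (R2 * R3 * R4)%N%:R * ((delta n)%:~R * (S / p%:R))
     - (R2 * R3 * R4)%N%:R * (z 4%N)%:~R * q%:R * ze; last by solve_Aint.
  have k1E : (k * 1 %/ 5 = 0)%N by rewrite muln1 divn_small.
  rewrite /S /S' !big_ord_recr !big_ord0 /= !add0r /z' /= muln0 div0n k1E.
  have -> : tail_eval n t x = x ^+ 4 + (p * (q * b * c ^ 2 * d ^ 3 * e ^ 5))%N%:R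
      * (g4%:~R * x ^+ 3 + g3%:~R * x ^+ 2 + g2%:~R * x + g1%:~R).
    rewrite /tail_eval tc1E tc2E tc3E tc4E DpE' !intrM -!pmulrn natrM.
    by ring.
  have -> : (p * (q * b * c ^ 2 * d ^ 3 * e ^ 5) =
      p * q * e * (b * c ^ 2 * d ^ 3 * e ^ 4))%N.
    by ring.
  rewrite R2E R3E R4E /eta /ze !(exprS _ (_ %/ 5)%N) !(natrM, natrX) !intrM -!pmulrn.
  have nzp := natr_neq0 p_gt0; have nzR m pm := natr_neq0 (R_gt0 m pm).
  by field; rewrite delta_nz nz nzp (nzR _ pR2) (nzR _ pR3) (nzR _ pR4) !expf_neq0.
have pdelta : ~~ (p %| `|delta n|)%N.
  apply/negP => pd; have : (p%:Z %| gcdz (delta n) (Delta n))%Z.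
    by rewrite dvdz_gcd dvdzE pd DpE' dvdz_mulr.
  by rewrite (eqP (coprime_delta_Delta n)) dvdzE /= dvdn1; case: (p) p_pr => [|[|]].
move/(eta_comb_dvd p_pr k_gt0 k_lt5 eta5 VA V'A ioA VVE wN) => pz i i5.
have := pz i i5; rewrite /z' !dvdzE.
case: i i5 => [|[|[|[|[|i]]]]] //= _; rewrite !(abszM, absz_nat) !Euclid_dvdM //;
  by rewrite ?(negPf pR2) ?(negPf pR3) ?(negPf pR4) ?(negPf pdelta) ?orbF.
Qed.

(** Exactly one of a, b, c, d is divisible by p: its cofactor is prime to p by squarefreeness, the
    other three by coprimality. *)
Lemma basis_local (p : nat) (z : nat -> int) :
    prime p -> (p %| a * b * c * d)%N ->
    (\sum_(i < 5) (z i)%:~R * (basis_seq n t b c d e x)`_i) / p%:R \in Aint ->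
  forall i, (i < 5)%N -> (p%:Z %| z i)%Z.
Proof.
move=> p_pr pq zA; case: sqf => sa sb sc sd.
move: cop; rewrite /= !andbT => /and3P[/and3P[ab ac ad] /andP[bc bd] cd].
have sqf_ndvd m m' : squarefree m -> m = (m' * p)%N -> ~~ (p %| m')%N.
  move=> sm mE; apply/negP => /dvdnP[m'' m'E].
  have p1 : p = 1%N by apply: sm; rewrite mE m'E -mulnA mulnn dvdn_mull.
  by move: p_pr; rewrite p1.
have cop_ndvd m1 m2 : coprime m1 m2 -> (p %| m1)%N -> ~~ (p %| m2)%N.
  move=> c12 p1; apply/negP => p2; have : (p %| gcdn m1 m2)%N by rewrite dvdn_gcd p1.
  by rewrite (eqP c12) dvdn1; case: (p) p_pr => [|[|]].
have p_case : [|| p %| a, p %| b, p %| c | p %| d]%N.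
  by move: pq; rewrite !Euclid_dvdM // -!orbA.
case/or4P: p_case => pm; case/dvdnP: (pm) => m mE.
- have nm := sqf_ndvd _ _ sa mE.
  apply: (@basis_local_core p 1 (m * b ^ 2 * c ^ 3 * d ^ 4) (c * d) (b * c * d ^ 2)
    (b * c ^ 2 * d ^ 3)) => //; try exact: esym (mul1n _).
    by rewrite mE; ring.
  rewrite !(Euclid_dvdM, Euclid_dvdX) // !negb_or ?negb_and nm.
  by rewrite (cop_ndvd _ _ ab) ?(cop_ndvd _ _ ac) ?(cop_ndvd _ _ ad).
- have nm := sqf_ndvd _ _ sb mE.
  apply: (@basis_local_core p 2 (a * m ^ 2 * c ^ 3 * d ^ 4) (c * d) (m * c * d ^ 2)
    (m * c ^ 2 * d ^ 3)) => //; try exact: esym (mul1n _); rewrite ?mE; try by ring.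
  rewrite !(Euclid_dvdM, Euclid_dvdX) // !negb_or ?negb_and nm.
  rewrite coprime_sym in ab.
  by rewrite (cop_ndvd _ _ ab) ?(cop_ndvd _ _ bc) ?(cop_ndvd _ _ bd).
- have nm := sqf_ndvd _ _ sc mE.
  apply: (@basis_local_core p 3 (a * b ^ 2 * m ^ 3 * d ^ 4) (m * d) (b * m * d ^ 2)
    (b * m ^ 2 * d ^ 3)) => //; rewrite ?mE; try by ring.
  rewrite !(Euclid_dvdM, Euclid_dvdX) // !negb_or ?negb_and nm.
  rewrite coprime_sym in ac; rewrite coprime_sym in bc.
  by rewrite (cop_ndvd _ _ ac) ?(cop_ndvd _ _ bc) ?(cop_ndvd _ _ cd).
- have nm := sqf_ndvd _ _ sd mE.
  apply: (@basis_local_core p 4 (a * b ^ 2 * c ^ 3 * m ^ 4) (c * m) (b * c * m ^ 2)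
    (b * c ^ 2 * m ^ 3)) => //; rewrite ?mE; try by ring.
  rewrite !(Euclid_dvdM, Euclid_dvdX) // !negb_or ?negb_and nm.
  rewrite coprime_sym in ad; rewrite coprime_sym in bd; rewrite coprime_sym in cd.
  by rewrite (cop_ndvd _ _ ad) ?(cop_ndvd _ _ bd) ?(cop_ndvd _ _ cd).
Qed.

(** Strong induction on N: [basis_local] extracts one prime p from all the coefficients, leaving the
    same quotient with denominator N / p. *)
Lemma basis_strip (N : nat) (z : nat -> int) :
    (0 < N)%N -> (forall p, prime p -> p %| N -> p %| a * b * c * d)%N ->
    (\sum_(i < 5) (z i)%:~R * (basis_seq n t b c d e x)`_i) / N%:R \in Aint ->
  forall i, (i < 5)%N -> (N%:Z %| z i)%Z.
Proof.
elim/ltn_ind: N z => N IHN z N0 Nq zA i i5.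
have [N1|N1] := leqP N 1; first by rewrite (eqP (_ : N == 1%N)) ?dvd1z // eqn_leq N1.
have p_pr := pdiv_prime N1; set p := pdiv N in p_pr.
have p0 := prime_gt0 p_pr.
have /dvdnP[M ME] : (p %| N)%N := pdiv_dvd N.
have M0 : (0 < M)%N by move: N0; rewrite ME muln_gt0 => /andP[].
have zpA : (\sum_(i < 5) (z i)%:~R * (basis_seq n t b c d e x)`_i) / p%:R \in Aint.
  set S := \sum_(i < 5) _ in zA *.
  have -> : S / p%:R = M%:R * (S / N%:R).
    by rewrite ME natrM; field; rewrite !natr_neq0.
  by apply: rpredM => //; exact: rpred_nat.
have pz := basis_local p_pr (Nq p p_pr (pdiv_dvd N)) zpA.
pose z' j := (z j %/ p%:Z)%Z.
have zE j : (j < 5)%N -> z j = z' j * p%:Z by move=> j5; rewrite /z' divzK // pz.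
rewrite zE // ME PoszM; apply: dvdz_mul => //.
apply: IHN i5 => //.
- by rewrite ME ltn_Pmulr // prime_gt1.
- by move=> l l_pr lM; apply: Nq => //; rewrite ME dvdn_mulr.
suff -> : (\sum_(i < 5) (z' i)%:~R * (basis_seq n t b c d e x)`_i) / M%:R =
    (\sum_(i < 5) (z i)%:~R * (basis_seq n t b c d e x)`_i) / N%:R by [].
rewrite !mulr_suml; apply: eq_bigr => j _; rewrite (zE j) // intrM ME natrM -pmulrn.
by field; rewrite !natr_neq0.
Qed.

End Root.

(** * The five conjugates: discriminant of the basis and integral coordinates *)

Section Conjugates.
Variable x : 'rV[algC]_5.
Hypothesis x_split : map_poly intr (quintic n) = \prod_(j < 5) ('X - (x 0 j)%:P).

Let x_root j : root (map_poly intr (quintic n)) (x 0 j).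
Proof.
by rewrite x_split /root horner_prod (bigD1 j) //= hornerXsubC subrr mul0r.
Qed.

Definition basis_mx : 'M[algC]_5 :=
  \matrix_(i, j) (basis_seq n t b c d e (x 0 j - t%:~R))`_i.

Definition transition_mx : 'M[algC]_5 :=
  let M := (b * c ^ 2 * d ^ 3 * e ^ 4)%N%:R * (delta n)%:~R in
  \matrix_(i, j) (nth [::] [:: [:: 1]; [:: 0; e%:R^-1];
    [:: 0; 0; (c * d * e ^ 2)%N%:R^-1];
    [:: 0; 0; 0; (b * c * d ^ 2 * e ^ 3)%N%:R^-1];
    [:: (tc1 n t)%:~R / M; (tc2 n t)%:~R / M; (tc3 n t)%:~R / M; (tc4 n t)%:~R / M;
        M^-1]] i)`_j.

Lemma basis_mxE :
  basis_mx = transition_mx *m Vandermonde 5 (\row_j (x 0 j - t%:~R)).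
Proof.
apply/matrixP => i j; rewrite !mxE !big_ord_recl big_ord0 !mxE /= /bump /=.
case: i => [[|[|[|[|[|i]]]]] ii] //=; rewrite ?nth_nil !(mul0r, add0r, addr0) ?expr0;
  try by ring.
by rewrite /tail_eval; ring.
Qed.

(** Translation by t preserves the Vandermonde determinant, and delta^2 Delta^4 over the squared
    product of the denominators is (abcd)^4. Squares avoid fixing a sign. *)
Lemma det_basis_mx : \det basis_mx ^+ 2 = ((a * b * c * d)%N%:R ^+ 2) ^+ 2.
Proof.
rewrite basis_mxE det_mulmx exprMn.
have -> : \det (Vandermonde 5 (\row_j (x 0 j - t%:~R))) = \det (Vandermonde 5 x).
  rewrite !det_Vandermonde; apply: eq_bigr => i _; apply: eq_bigr => j _.
  by rewrite !mxE; ring.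
rewrite (quintic_disc x_split) det_trig; last first.
  apply/is_trig_mxP => i j; rewrite mxE.
  by case: i j => [[|[|[|[|[|i]]]]] ii] [[|[|[|[|[|j]]]]] jj].
rewrite !big_ord_recl big_ord0 !mxE /= DE !(intrM, rmorphXn) /= -!pmulrn.
rewrite !(natrM, natrX).
by field; rewrite !nz delta_nz.
Qed.

Lemma basis_coord_int (y : nat -> rat) :
    (forall j, \sum_(i < 5) ratr (y i) * (basis_seq n t b c d e (x 0 j - t%:~R))`_i
       \in Aint) ->
  forall i, (i < 5)%N -> exists z : int, y i = z%:~R.
Proof.
move=> yA; set q := (a * b * c * d)%N.
have q0 : (0 < q)%N by rewrite !muln_gt0 a0 b0 c0 d0.
have qy i : (i < 5)%N -> exists z : int, y i * (q ^ 2)%N%:R = z%:~R.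
  move=> i5; apply: Aint_ratP; rewrite rmorphM /= ratr_nat.
  apply: (@Aint_root 2) => //.
  have -> : (ratr (y i) * (q ^ 2)%N%:R) ^+ 2 = (ratr (y i) * \det basis_mx) ^+ 2.
    by rewrite !exprMn det_basis_mx natrX.
  apply: rpredX.
  have := @cramer_Aint _ basis_mx (\row_i ratr (y i)) _ _ (Ordinal i5).
  rewrite mxE; apply.
    by move=> k l; rewrite mxE; exact: basis_Aint.
  move=> j; rewrite mxE; under eq_bigr => k _ do rewrite !mxE.
  exact: yA.
have qQ0 : (q ^ 2)%N%:R != 0 :> rat by rewrite pnatr_eq0 -lt0n expn_gt0 q0.
pose z i := numq (y i * (q ^ 2)%N%:R).
have zE i : (i < 5)%N -> y i = (z i)%:~R / (q ^ 2)%N%:R.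
  by move=> i5; rewrite /z; have [w wE] := qy i i5; rewrite wE numq_int -wE mulfK.
have zC i : (i < 5)%N -> ratr (y i) = (z i)%:~R / (q ^ 2)%N%:R :> algC.
  by move/zE => {1}->; rewrite fmorph_div /= ratr_int ratr_nat.
(* All primes dividing q^2 divide abcd, so the denominator can be cleared at any one of the
   roots. *)
have zd : forall i, (i < 5)%N -> ((q ^ 2)%N%:Z %| z i)%Z.
  apply: (@basis_strip (x 0 ord0)); first exact: x_root.
  - by rewrite expn_gt0 q0.
  - by move=> p p_pr; rewrite Euclid_dvdX // andbT.
  rewrite mulr_suml; under eq_bigr => i _ do rewrite mulrAC -zC //.
  exact: yA.
move=> i i5; have /dvdzP[w wE] := zd i i5; exists w.
by rewrite zE // wE intrM -pmulrn mulfK.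
Qed.
End Conjugates.

End Basis.

(** * Passage to the number field *)

Lemma map_intr_quintic (F : fieldType) (iota : {rmorphism rat -> F}) n :
  map_poly intr (quintic n) = map_poly iota (map_poly intr (quintic n)).
Proof.
by rewrite -map_poly_comp; apply: eq_map_poly => z /=; rewrite rmorph_int.
Qed.

(** An irreducible polynomial of degree 5 has no rational root, so rho differs from t and the
    division is legitimate. *)
Lemma quintic_quotient_tail (L : fieldExtType rat) n t (rho : L) :
  root (map_poly intr (quintic n)) rho ->
  quintic_quotient n t rho = tail_eval n t (rho - t%:~R).
Proof.
move=> rho_root; rewrite quintic_quotientE; last first.
  apply/eqP => rhoE; have irr := irreducible_quintic n.
  move: rho_root; rewrite (map_intr_quintic (GRing.in_alg L)) => rho_root.
  have : root (map_poly (GRing.in_alg L) ('X - (t%:~R)%:P)) rho.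
    by rewrite map_polyXsubC root_XsubC rhoE rmorph_int.
  rewrite (root_irreducible _ irr rho_root) => /dvdp_leq.
  rewrite polyXsubC_eq0 => /(_ isT); rewrite size_XsubC.
  by rewrite size_map_inj_poly ?size_quintic //; exact: intr_inj.
by rewrite /tail_eval /tc1 /tc2 /tc3 /tc4; ring.
Qed.

Theorem theorem2p1 (n : int) (L : fieldExtType rat) (rho : L)
    (a b c d e : nat) (u t : int)
    (rho_root : root (map_poly intr (quintic n)) rho)
    (abcde_gt0 : [/\ (0 < a)%N, (0 < b)%N, (0 < c)%N, (0 < d)%N & (0 < e)%N])
    (Delta_fact : Delta n = (a * b ^ 2 * c ^ 3 * d ^ 4 * e ^ 5)%N%:Z)
    (abcd_sqfree : [/\ squarefree a, squarefree b, squarefree c & squarefree d])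
    (abcd_coprime : pairwise coprime [:: a; b; c; d])
    (n_ndvd5 : ~~ (5 %| n)%Z)
    (u_inv5 : (5 * u = 1 %[mod Delta n])%Z)
    (t_cong :
      (t = (n ^+ 2 + 3 * n + 4)
             * (11 * n ^+ 5 + 110 * n ^+ 4 + 440 * n ^+ 3 + 903 * n ^+ 2
                + 940 * n + 390) * Delta n
           - u * n ^+ 2 * (11 * n ^+ 3 + 55 * n ^+ 2 + 110 * n + 199)
             * delta n ^+ 2
        %[mod Delta n * delta n ^+ 2])%Z) :
  integral_basis <<1; rho>>%AS
    [tuple 1;
       (rho - t%:~R) / e%:R;
       (rho - t%:~R) ^+ 2 / (c * d * e ^ 2)%N%:R;
       (rho - t%:~R) ^+ 3 / (b * c * d ^ 2 * e ^ 3)%N%:R;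
       quintic_quotient n t rho
         / ((b * c ^ 2 * d ^ 3 * e ^ 4)%N%:R * (delta n)%:~R)].
Proof.
case: abcde_gt0 => a0 b0 c0 d0 e0.
have [s [w [tD td]]] := t_residues u_inv5 t_cong.
have cop5 : coprimez 5 (Delta n).
  move/eqP: u_inv5; rewrite eqz_mod_dvd => /dvdzP[k kE].
  by apply/coprimezP; exists (u, - k); rewrite /= mulNr -kE; ring.
have [/dvdzP[g0 tc0E] /dvdzP[g1 tc1E] /dvdzP[g2 tc2E] /dvdzP[g3 tc3E]
  /dvdzP[g4 tc4E]] := Delta_dvd_tc tD cop5.
have [/dvdzP[k0 tc0E'] /dvdzP[k1 tc1E']] := delta_dvd_tc td.
rewrite mulrC in tc0E; rewrite mulrC in tc1E; rewrite mulrC in tc2E.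
rewrite mulrC in tc3E; rewrite mulrC in tc4E.
rewrite mulrC in tc0E'; rewrite mulrC in tc1E'.
have D0 : Delta n != 0.
  by rewrite Delta_fact eqz_nat -lt0n !(muln_gt0, expn_gt0) a0 b0 c0 d0 e0.
have cop_g0 := coprime_tc0_Delta tD cop5 D0 tc0E.
pose iL := GRing.in_alg L : {rmorphism rat -> L}.
pose P := comb_poly n t b c d e.
have irr := irreducible_quintic n.
have rho_rootQ : root (map_poly iL (map_poly intr (quintic n))) rho.
  by rewrite -map_intr_quintic.
have szf : size (map_poly intr (quintic n) : {poly rat}) = 6%N.
  by rewrite size_map_inj_poly ?size_quintic //; exact: intr_inj.
have [x x_split] := quintic_split n.
have x_root j : root (map_poly intr (quintic n)) (x 0 j).
  by rewrite x_split /root horner_prod (bigD1 j) //= hornerXsubC subrr mul0r.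
have x_rootQ j : root (map_poly ratr (map_poly intr (quintic n))) (x 0 j).
  by rewrite -(map_intr_quintic (ratr : {rmorphism rat -> algC})).
set W := [tuple _; _; _; _; _].
have WE (z : 'I_5 -> int) (y : nat -> rat) : (forall i : 'I_5, y i = (z i)%:~R) ->
    \sum_(i < 5) tnth W i *~ z i = (map_poly iL (P y)).[rho].
  move=> yE; rewrite horner_comb_poly; apply: eq_bigr => i _.
  by rewrite yE rmorph_int mulrzl (tnth_nth 0) /W /= quintic_quotient_tail.
pose ext (z : 'I_5 -> int) k : rat := (z (inord k))%:~R.
have extE z (i : 'I_5) : ext z i = (z i)%:~R by rewrite /ext inord_val.
split=> [v|z]; last first.
  rewrite (WE _ (ext z)); last exact: extE.
  move/rootP; rewrite (root_irreducible _ irr rho_rootQ) => fP.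
  (* A multiple of f_n of degree at most 4 vanishes. *)
  have P0 : P (ext z) = 0.
    apply/eqP; apply: contraTT fP => P0; apply/negP => /(dvdp_leq P0).
    by rewrite szf leqNgt ltnS size_comb_poly.
  move=> i; have := comb_poly_eq0 b0 c0 d0 e0 P0 (ltn_ord i).
  by rewrite extE => /eqP; rewrite intr_eq0 => /eqP.
split=> [[vK vint]|[z ->]]; last first.
  rewrite (WE _ (ext z)); last exact: extE.
  split.
    by apply: mempx_Fadjoin; apply/polyOver1P; exists (P (ext z)).
  (* One complex root suffices to test integrality. *)
  apply: (integral_transfer (iE := ratr : {rmorphism rat -> algC}) irr
    (x_rootQ ord0)) => //.
  apply/integral_algC; rewrite horner_comb_poly; apply: rpred_sum => i _.
  apply: rpredM; first by rewrite /= extE ratr_int Aint_int.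
  exact: (basis_Aint b0 c0 d0 e0 Delta_fact tc0E tc1E tc2E tc3E tc4E tc0E' tc1E').
have /polyOver1P[p pE] := Fadjoin_polyOver 1%VS rho v.
(* Reduction modulo f_n keeps the value at rho and brings the degree down to at most 4. *)
have vE : v = (map_poly iL (p %% map_poly intr (quintic n))).[rho].
  rewrite -(Fadjoin_poly_eq vK) pE {1}(divp_eq p (map_poly intr (quintic n))).
  by rewrite rmorphD rmorphM /= hornerD hornerM (rootP rho_rootQ) mulr0 add0r.
have [y yE] : exists y, p %% map_poly intr (quintic n) = P y.
  apply: comb_polyP => //; rewrite -ltnS -szf ltn_modp.
  by rewrite -size_poly_eq0 szf.
(* Integrality passes from rho to all five complex roots, as Cramer's rule requires. *)
have y_int : forall i, (i < 5)%N -> exists z : int, y i = z%:~R.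
  apply: (basis_coord_int a0 b0 c0 d0 e0 Delta_fact tc0E tc1E tc2E tc3E tc4E tc0E' tc1E'
    cop_g0 abcd_sqfree abcd_coprime x_split) => j.
  rewrite -(horner_comb_poly (ratr : {rmorphism rat -> algC})).
  apply/integral_algC; rewrite -/P -yE.
  by apply: (integral_transfer irr rho_rootQ (x_rootQ j)); rewrite -vE.
exists [ffun i : 'I_5 => numq (y i)].
rewrite vE yE; apply/esym; apply: WE => i.
by rewrite ffunE; have [z ->] := y_int i (ltn_ord i); rewrite numq_int.
Qed.
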